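(* Let $n\ge3$, $\lambda_1,\dots,\lambda_n\in\mathbb{C}$, and let \[\Gamma:\ \{1\}\sqcup\dots\sqcup\{n\}\stackrel{(I_1,J_1)}{\longrightarrow}\cdots\stackrel{(I_{n-1},J_{n-1})}{\longrightarrow}\{1,\dots,n\}\] be a coupling scheme. For integers $k_1,\dots,k_{n-1}\ge0$, let \[v_{k_1,\dots,k_{n-1}}=\prod_{b=1}^{n-1}(x_{I_b\cup J_b})^{k_b}\,P_{k_b}^{\lambda^{(\vec k)}_{I_b},\lambda^{(\vec k)}_{J_b}}(u_{I_b,J_b}).\] Then the vectors $\{v_{k_1,\dots,k_{n-1}}\}_{k_1,\dots,k_{n-1}\ge0}$ are common eigenvectors for the commutative family of operators $S_\Gamma=\{C'_{I_1\cup J_1},\dots,C'_{I_{n-1}\cup J_{n-1}}\}$ on $\mathbb{C}[x_1,\dots,x_n]$, with eigenvalues given, for $b=1,\dots,n-1$, by \[C'_{I_b\cup J_b}(v_{k_1,\dots,k_{n-1}})=\Bigl(\sum_{a\preceq b}k_a\Bigr)\Bigl(\sum_{a\preceq b}k_a+\lambda_{I_b}+\lambda_{J_b}-1\Bigr)v_{k_1,\dots,k_{n-1}}.\]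
   Context: Operators. $sl_2$ has generators $H,E,F$ with $[H,E]=2E$, $[H,F]=-2F$, $[E,F]=H$, and Casimir element $C=\frac{H^2+2H}{4}+FE\in U(sl_2)$. The algebra $U(sl_2)^{\otimes n}$ acts on $\mathbb{C}[x_1,\dots,x_n]$ (realising the tensor product $V_{\lambda_1}\otimes\dots\otimes V_{\lambda_n}$ of lowest-weight Verma modules), the $i$-th tensor factor acting by $H\mapsto\lambda_i+2x_i\partial_{x_i}$, $E\mapsto x_i$ (multiplication), $F\mapsto-x_i\partial_{x_i}^2-\lambda_i\partial_{x_i}$. For $I\subset\{1,\dots,n\}$, $\delta_I:U(sl_2)\to U(sl_2)^{\otimes n}$ is the algebra morphism sending $x\in sl_2$ to $\sum_{i\in I}1\otimes\cdots\otimes x\otimes\cdots\otimes1$ ($x$ in position $i$). Set $C_I=\delta_I(C)$, $\lambda_I=\sum_{i\in I}\lambda_i$ and $C'_I=C_I-\frac{\lambda_I(\lambda_I-2)}4$; these are identified with their actions on $\mathbb{C}[x_1,\dots,x_n]$. Coupling schemes. Partitions of $\{1,\dots,n\}$ are written $K_1\sqcup\dots\sqcup K_m$ with $\min K_1<\dots<\min K_m$. A coupling step $(K_a,K_b)$, $a<b$, transforms such a partition into the one in which $K_a$ and $K_b$ are removed and replaced by their union $K_a\cup K_b$. A coupling scheme is a sequence of $n-1$ coupling steps $(I_1,J_1),\dots,(I_{n-1},J_{n-1})$ from $\{1\}\sqcup\dots\sqcup\{n\}$ to the trivial partition $\{1,\dots,n\}$. Variables. For $I\subset\{1,\dots,n\}$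 put $x_I=\sum_{i\in I}x_i$, and for disjoint nonempty $I,J$ put $u_{I,J}=\frac{x_J-x_I}{x_I+x_J}$. Order notation. For $1\le a<b\le n-1$, write $a\prec_Lb$ if $I_a\cup J_a\subset I_b$, and $a\prec_Rb$ if $I_a\cup J_a\subset J_b$. Write $a\preceq b$ if $a=b$ or $a\prec_Lb$ or $a\prec_Rb$. For $\vec k=(k_1,\dots,k_{n-1})$, \[\bigl(\lambda^{(\vec k)}_{I_b},\lambda^{(\vec k)}_{J_b}\bigr)=\Bigl(\lambda_{I_b}+2\sum_{a\prec_Lb}k_a,\ \lambda_{J_b}+2\sum_{a\prec_Rb}k_a\Bigr).\] Jacobi polynomials (shifted parametrisation, usual parameters $\alpha=\lambda-1,\beta=\lambda'-1$): for $\lambda,\lambda'\in\mathbb{C}$, $l\ge0$, \[P^{\lambda,\lambda'}_l(x)=\frac1{2^l}\sum_{s=0}^l(-1)^s\binom{l+\lambda-1}{l-s}\binom{l+\lambda'-1}{s}(1-x)^s(1+x)^{l-s},\] with generalised binomial coefficients $\binom{a}{j}=\frac{a(a-1)\cdots(a-j+1)}{j!}$.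
   Formalization: The eigenvalue equations are proved for all parameters, but the vector v is claimed non-zero only when none of its Jacobi polynomials vanishes identically; otherwise v = 0 (e.g. λ_1=λ_2=0, first step ({1},{2}), k_1=1, as P_1^{0,0}=0). *)

(* Defs.v *)
From HB Require Import structures.
From mathcomp Require Import all_boot all_order all_algebra.
From mathcomp Require Import fraction.
From mathcomp Require Import reals complex mpoly.

Set Implicit Arguments.
Unset Strict Implicit.
Unset Printing Implicit Defensive.

Import GRing.Theory.
Local Open Scope ring_scope.

Section CouplingScheme.
Variable n : nat.

(* Junk value [n] on the empty set. *)
Definition set_min (A : {set 'I_n}) : nat := \big[minn/n]_(i in A) (i : nat).

(* A partition of the index set is kept as an unordered set of blocks: in the
   enumeration by increasing minima, the block [A] comes before the block [B]
   exactly when [set_min A < set_min B]. *)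
Definition coupling_step (P : {set {set 'I_n}}) (A B : {set 'I_n})
    (Q : {set {set 'I_n}}) : Prop :=
  [/\ A \in P, B \in P, (set_min A < set_min B)%N
    & Q = (A :|: B) |: (P :\: [set A; B])].

Definition coupling_scheme (I J : 'I_n.-1 -> {set 'I_n}) : Prop :=
  exists P : nat -> {set {set 'I_n}},
    [/\ P 0%N = [set [set i] | i : 'I_n],
        P n.-1 = [set [set: 'I_n]]
      & forall b : 'I_n.-1, coupling_step (P b) (I b) (J b) (P b.+1)].

Variables I J : 'I_n.-1 -> {set 'I_n}.

Definition precL (a b : 'I_n.-1) : bool :=
  (a < b)%N && (I a :|: J a \subset I b).

Definition precR (a b : 'I_n.-1) : bool :=
  (a < b)%N && (I a :|: J a \subset J b).

Definition preceq (a b : 'I_n.-1) : bool := [|| a == b, precL a b | precR a b].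

End CouplingScheme.

Section Jacobi.
Variable K : fieldType.

Definition gbinom (a : K) (j : nat) : K := (\prod_(i < j) (a - i%:R)) / (j`!)%:R.

Definition jacobi (lam mu : K) (l : nat) : {poly K} :=
  (2 ^+ l)^-1 *: \sum_(s < l.+1)
    ((-1) ^+ s * gbinom (l%:R + lam - 1) (l - s) * gbinom (l%:R + mu - 1) s)
      *: ((1 - 'X) ^+ s * (1 + 'X) ^+ (l - s)).

End Jacobi.

Section Operators.
Variables (K : fieldType) (n : nat) (lam : 'I_n -> K).
Local Notation pol := {mpoly K[n]}.

Definition actH (i : 'I_n) (p : pol) : pol := lam i *: p + ('X_i * mderiv i p) *+ 2.
Definition actE (i : 'I_n) (p : pol) : pol := 'X_i * p.
Definition actF (i : 'I_n) (p : pol) : pol :=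
  - ('X_i * mderiv i (mderiv i p)) - lam i *: mderiv i p.

(* The action of [delta_A x] for [x] one of the generators of sl2, [X i] being
   the action of [x] in the [i]-th tensor factor. *)
Definition delta (A : {set 'I_n}) (X : 'I_n -> pol -> pol) (p : pol) : pol :=
  \sum_(i in A) X i p.

(* The Casimir element (H^2 + 2 H) / 4 + F E, for operators [h], [e], [f]
   giving the action of the generators H, E, F. *)
Definition casimir (h e f : pol -> pol) (p : pol) : pol :=
  4^-1 *: (h (h p) + h p *+ 2) + f (e p).

(* Since [delta_A] is an algebra morphism, [delta_A C] acts by the Casimir
   expression in the operators [delta_A H], [delta_A E], [delta_A F]. *)
Definition casimir_set (A : {set 'I_n}) : pol -> pol :=
  casimir (delta A actH) (delta A actE) (delta A actF).

Definition lam_set (A : {set 'I_n}) : K := \sum_(i in A) lam i.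

Definition casimir_set' (A : {set 'I_n}) (p : pol) : pol :=
  casimir_set A p - (lam_set A * (lam_set A - 2) / 4) *: p.

End Operators.

Section Vectors.
Variables (K : fieldType) (n : nat).

(* [u_{A,B}] is a rational function, so the vectors [v_k] are first written in
   the field of fractions of the polynomial ring. *)
Local Notation rfun := {fraction {mpoly K[n]}}.

Definition frac_const (c : K) : rfun := tofrac (c%:MP_[n]).

Definition xset (A : {set 'I_n}) : {mpoly K[n]} := \sum_(i in A) 'X_i.

Definition uvar (A B : {set 'I_n}) : rfun :=
  (tofrac (xset B) - tofrac (xset A)) / (tofrac (xset A) + tofrac (xset B)).

Variables (lam : 'I_n -> K) (I J : 'I_n.-1 -> {set 'I_n}) (k : 'I_n.-1 -> nat).

Definition lamL (b : 'I_n.-1) : K :=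
  lam_set lam (I b) + 2 * (\sum_(a | precL I J a b) k a)%N%:R.

Definition lamR (b : 'I_n.-1) : K :=
  lam_set lam (J b) + 2 * (\sum_(a | precR I J a b) k a)%N%:R.

Definition jacobi_factor (b : 'I_n.-1) : {poly K} := jacobi (lamL b) (lamR b) (k b).

Definition coupled_vector : rfun :=
  \prod_(b < n.-1)
    (tofrac (xset (I b :|: J b)) ^+ k b
     * (map_poly frac_const (jacobi_factor b)).[uvar (I b) (J b)]).

Definition ksum (b : 'I_n.-1) : nat := (\sum_(a | preceq I J a b) k a)%N.

Definition eigval (b : 'I_n.-1) : K :=
  (ksum b)%:R
    * ((ksum b)%:R + lam_set lam (I b) + lam_set lam (J b) - 1).

End Vectors.

(* Main.v *)
(* On polynomials killed by F_A and homogeneous of degree k in the variables of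
   A, the operator C'_A is the scalar k (k + lambda_A - 1), and C'_A commutes with
   multiplication by x_B as soon as A is contained in B or disjoint from B.
   Clearing denominators, v_k is a product of factors Q_b, homogeneous of degree
   k_b in the two linear forms x_(I_b), x_(J_b). By laminarity of the blocks, the
   factors Q_a with a not below b pass through C'_(I_b u J_b). The product of the
   remaining ones is killed by F_(I_b u J_b), by induction along the scheme: the
   recurrence satisfied by the Jacobi coefficients says exactly that Q_b sends a
   product of lowest-weight vectors of weights lambda^(k)_(I_b), lambda^(k)_(J_b)
   to a lowest-weight vector. *)
Require Import Defs.
From HB Require Import structures.
From mathcomp Require Import all_boot all_order all_algebra.
From mathcomp Require Import fraction.
From mathcomp Require Import reals complex mpoly.
From mathcomp Require Import ring.

Set Implicit Arguments.
Unset Strict Implicit.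
Unset Printing Implicit Defensive.

Import GRing.Theory.
Local Open Scope ring_scope.

(** * Brackets of the sl2 generators acting in single tensor factors *)

Section Generators.
Variables (K : fieldType) (n : nat) (lam : 'I_n -> K).
Local Notation pol := {mpoly K[n]}.

Lemma mderiv_mulX (i j : 'I_n) (p : pol) :
  mderiv i ('X_j * p) = 'X_j * mderiv i p + p *+ (i == j).
Proof.
rewrite mderivM mderivX mnm1E eq_sym addrC; congr (_ + _).
case: eqP => [->|_]; last by rewrite scale0r mul0r mulr0n.
have -> : (U_(j) - U_(j))%MM = 0%MM :> 'X_{1..n} by apply/mnmP=> k; rewrite mnmBE subnn mnm0E.
by rewrite scale1r mpolyX0 mul1r.
Qed.

Fact actH_is_linear i : linear (actH lam i).
Proof.
move=> c p q; rewrite /actH mderivD mderivZ -!mul_mpolyC; ring.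
Qed.
HB.instance Definition _ i :=
  GRing.isLinear.Build K pol pol _ (actH lam i) (actH_is_linear i).

Fact actE_is_linear i : linear (@actE K n i).
Proof. by move=> c p q; rewrite /actE -!mul_mpolyC; ring. Qed.
HB.instance Definition _ i :=
  GRing.isLinear.Build K pol pol _ (@actE K n i) (actE_is_linear i).

Fact actF_is_linear i : linear (actF lam i).
Proof.
by move=> c p q; rewrite /actF !(mderivD, mderivZ) -!mul_mpolyC; ring.
Qed.
HB.instance Definition _ i :=
  GRing.isLinear.Build K pol pol _ (actF lam i) (actF_is_linear i).

Definition act_simp :=
  (mderivD, mderivB, mderivN, mderivZ, mderivMn, mderiv_mulX).

Lemma actHE i j (p : pol) :
  actH lam i (actE j p) = actE j (actH lam i p) + actE i p *+ 2 *+ (i == j).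
Proof.
rewrite /actH /actE !act_simp -!mul_mpolyC.
by case: eqP => [->|_]; rewrite ?mulr1n ?mulr0n; ring.
Qed.

Lemma actHH i j (p : pol) :
  actH lam i (actH lam j p) = actH lam j (actH lam i p).
Proof.
rewrite /actH !act_simp -!mul_mpolyC (mderiv_comm j i).
by case: (eqVneq i j) => [->|_]; rewrite ?eqxx ?mulr1n ?mulr0n; ring.
Qed.

Lemma actHF i j (p : pol) :
  actH lam i (actF lam j p)
  = actF lam j (actH lam i p) - actF lam i p *+ 2 *+ (i == j).
Proof.
rewrite /actH /actF !act_simp -!mul_mpolyC !(mderiv_comm j i).
by case: (eqVneq i j) => [->|_]; rewrite ?eqxx ?mulr1n ?mulr0n; ring.
Qed.

Lemma actEF i j (p : pol) :
  actE i (actF lam j p) = actF lam j (actE i p) + actH lam i p *+ (i == j).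
Proof.
rewrite /actE /actF /actH !act_simp -!mul_mpolyC.
by case: (eqVneq i j) => [->|_]; rewrite ?eqxx ?mulr1n ?mulr0n; ring.
Qed.

Lemma actFF i j (p : pol) :
  actF lam i (actF lam j p) = actF lam j (actF lam i p).
Proof.
case: (eqVneq i j) => [->//|ne].
rewrite /actF !act_simp -!mul_mpolyC !(mderiv_comm j i).
by rewrite (negPf ne) eq_sym (negPf ne) ?mulr0n; ring.
Qed.

End Generators.

Lemma sum_disjointU (V : nmodType) (T : finType) (A B : {set T}) (F : T -> V) :
  [disjoint A & B] ->
  \sum_(i in A :|: B) F i = \sum_(i in A) F i + \sum_(i in B) F i.
Proof.
by move=> AB; rewrite -bigU //=; apply: eq_bigl => i; rewrite !inE.
Qed.

(** * Diagonal operators attached to a set of indices *)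

Section Sets.
Variables (K : numFieldType) (n : nat) (lam : 'I_n -> K).
Local Notation pol := {mpoly K[n]}.
Implicit Types (A B : {set 'I_n}) (p : pol).

(** The three generators get names of their own so that each can carry a canonical linear
    structure. *)
Definition opH A p : pol := delta A (actH lam) p.
Definition opE A p : pol := delta A (@actE K n) p.
Definition opF A p : pol := delta A (actF lam) p.

Fact delta_is_linear A (X : 'I_n -> {linear pol -> pol}) : linear (delta A X).
Proof.
move=> c p q; rewrite /delta scaler_sumr -big_split.
by apply: eq_bigr => i _; rewrite linearP.
Qed.
HB.instance Definition _ A := GRing.isLinear.Build K pol pol _ (opH A)
  (delta_is_linear A (fun i => actH lam i)).
HB.instance Definition _ A := GRing.isLinear.Build K pol pol _ (opE A)
  (delta_is_linear A (fun i => @actE K n i)).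
HB.instance Definition _ A := GRing.isLinear.Build K pol pol _ (opF A)
  (delta_is_linear A (fun i => actF lam i)).

(** Distinct tensor factors commute, so in the double sum only the diagonal terms leave a bracket
    [Z], and these are indexed by the intersection of [A] and [B]. *)
Lemma delta_comm A B (X Y : 'I_n -> {linear pol -> pol}) (Z : 'I_n -> pol -> pol) :
  (forall i j p, X i (Y j p) = Y j (X i p) + Z i p *+ (i == j)) ->
  forall p, delta A X (delta B Y p)
    = delta B Y (delta A X p) + delta (A :&: B) Z p.
Proof.
move=> XY p; rewrite /delta.
under eq_bigr => i _ do rewrite linear_sum.
under [in X in _ = X + _]eq_bigr => j _ do rewrite linear_sum.
rewrite [in X in _ = X + _]exchange_big /=.
under [in X in _ = _ + X]eq_bigl => i do rewrite inE.
rewrite big_mkcondr -big_split /=; apply: eq_bigr => i _.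
under eq_bigr => j _ do rewrite XY.
rewrite big_split /=; congr (_ + _).
case: (boolP (i \in B)) => iB.
  rewrite (bigD1 i) //= eqxx big1 ?addr0 // => j /andP[_ /negPf].
  by rewrite eq_sym => ->.
by rewrite big1 // => j jB; case: eqP jB iB => // -> ->.
Qed.

Lemma opHE A B p : opH A (opE B p) = opE B (opH A p) + opE (A :&: B) p *+ 2.
Proof.
rewrite /opE {3}/delta -sumrMnl.
exact: (@delta_comm A B (fun i => actH lam i) (fun i => @actE K n i)
  (fun i q => actE i q *+ 2) (actHE lam)).
Qed.

Lemma opHF A B p : opH A (opF B p) = opF B (opH A p) - opF (A :&: B) p *+ 2.
Proof.
rewrite /opF {3}/delta -sumrMnl -sumrN.
apply: (@delta_comm A B (fun i => actH lam i) (fun i => actF lam i)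
  (fun i q => - (actF lam i q *+ 2))) => i j q.
by rewrite /= actHF mulNrn.
Qed.

Lemma opEF A B p : opE A (opF B p) = opF B (opE A p) + opH (A :&: B) p.
Proof.
exact: (@delta_comm A B (fun i => @actE K n i) (fun i => actF lam i)
  (actH lam) (actEF lam)).
Qed.

Lemma delta0 A p : delta A (fun _ _ => 0) p = 0 :> pol.
Proof. exact: big1. Qed.

Lemma opHH A B p : opH A (opH B p) = opH B (opH A p).
Proof.
rewrite -[RHS]addr0 -(delta0 (A :&: B) p).
apply: (@delta_comm A B (fun i => actH lam i) (fun i => actH lam i)) => i j q.
by rewrite /= actHH mul0rn addr0.
Qed.

Lemma opFF A B p : opF A (opF B p) = opF B (opF A p).
Proof.
rewrite -[RHS]addr0 -(delta0 (A :&: B) p).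
apply: (@delta_comm A B (fun i => actF lam i) (fun i => actF lam i)) => i j q.
by rewrite /= actFF mul0rn addr0.
Qed.

Lemma opE_mul A p : opE A p = xset K A * p.
Proof. by rewrite /xset mulr_suml. Qed.

Lemma opEE A B p : opE A (opE B p) = opE B (opE A p).
Proof. by rewrite !opE_mul mulrCA. Qed.

Lemma delta_set0 (X : 'I_n -> pol -> pol) p : delta set0 X p = 0.
Proof. exact: big_set0. Qed.

Lemma delta_setU A B (X : 'I_n -> pol -> pol) p :
  [disjoint A & B] -> delta (A :|: B) X p = delta A X p + delta B X p.
Proof. exact: sum_disjointU. Qed.

(** Not symmetric on purpose: the Casimir of [A] need not commute with the generators of a proper
    subset of [A]. *)
Definition nested A B := (A \subset B) || [disjoint A & B].

Lemma opH_xset_sub A B p : B \subset A ->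
  opH A (xset K B * p) = xset K B * opH A p + 2 *: (xset K B * p).
Proof.
by move=> /setIidPr BA; rewrite -!opE_mul opHE BA scaler_nat.
Qed.

Lemma opH_xset_disj A B p : [disjoint A & B] ->
  opH A (xset K B * p) = xset K B * opH A p.
Proof.
move=> /disjoint_setI0 AB; rewrite -!opE_mul opHE AB.
by rewrite [opE set0 _]delta_set0 mul0rn addr0.
Qed.

Lemma opF_xset_disj A B p : [disjoint A & B] ->
  opF A (xset K B * p) = xset K B * opF A p.
Proof.
move=> AB; rewrite -!opE_mul opEF.
have -> : B :&: A = set0 by rewrite setIC disjoint_setI0.
by rewrite [opH set0 _]delta_set0 addr0.
Qed.

Lemma opF_xset A p : opF A (xset K A * p) = xset K A * opF A p - opH A p.
Proof. by rewrite -!opE_mul opEF setIid addrK. Qed.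


End Sets.

(** * Centrality of the Casimir element, for abstract operators *)

Section CasimirCommutation.
Variables (K : numFieldType) (n : nat).
Local Notation pol := {mpoly K[n]}.
Variables h e f T : {linear pol -> pol}.

Lemma linear_casimir p : T (casimir h e f p) =
  4^-1 *: (T (h (h p)) + T (h p) *+ 2) + T (f (e p)).
Proof.
by rewrite /casimir (linearD T) (linearZZ T) (linearD T) (linearMn T).
Qed.

Lemma casimir_is_linear : linear (casimir h e f).
Proof.
move=> c p q; rewrite /casimir (linearP e) (linearP f) !(linearP h) /=.
rewrite -!mul_mpolyC; move: (h (h p)) (h p) (f (e p)) => a a' a''.
by move: (h (h q)) (h q) (f (e q)) c%:MP (4^-1)%:MP => *; ring.
Qed.

(** Brings the term created by the brackets in [f (e (T p))] under the scalar of the quadratic part,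
    so that an identity with integer coefficients remains. *)
Lemma scaleV4K (p : pol) : 4^-1 *: (p *+ 4) = p.
Proof.
by rewrite -scaler_nat scalerA mulVf ?scale1r // Num.Theory.pnatr_eq0.
Qed.

Lemma casimir_comm p :
  (forall q, h (T q) = T (h q)) -> (forall q, e (T q) = T (e q)) ->
  (forall q, f (T q) = T (f q)) -> casimir h e f (T p) = T (casimir h e f p).
Proof. by move=> hT eT fT; rewrite linear_casimir /casimir !(hT, eT, fT). Qed.

(** [T] stands for the H of a larger set. Both parts of the Casimir have weight zero: moving [T]
    past [e] and then [f] creates two copies of [f (e p)] with opposite signs. *)
Lemma casimir_comm_H p :
  (forall q, h (T q) = T (h q)) -> (forall q, e (T q) = T (e q) - e q *+ 2) ->
  (forall q, f (T q) = T (f q) + f q *+ 2) ->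
  casimir h e f (T p) = T (casimir h e f p).
Proof.
move=> hT eT fT; rewrite linear_casimir /casimir !hT eT.
by rewrite (linearB f) (linearMn f) fT addrK.
Qed.

(** [T] stands for the E of a larger set. The part in [h] gains 4 times [h (e p)] before division by
    4, which cancels the bracket of [f] with [T]. *)
Lemma casimir_comm_E p :
  (forall q, h (e q) = e (h q) + e q *+ 2) ->
  (forall q, h (T q) = T (h q) + e q *+ 2) -> (forall q, e (T q) = T (e q)) ->
  (forall q, f (T q) = T (f q) - h q) ->
  casimir h e f (T p) = T (casimir h e f p).
Proof.
move=> he hT eT fT; rewrite linear_casimir /casimir eT !hT fT.
rewrite (linearD h) (linearMn h) hT !he.
rewrite -[X in _ + (_ - X)]scaleV4K.
move: (T (h (h p))) (e (h p)) (e p) (T (h p)) (T (f (e p))) => a b c d q.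
rewrite addrCA [RHS]addrC; congr (_ + _); rewrite -scalerBr; congr (_ *: _).
by ring.
Qed.

(** [T] stands for the F of a larger set. The part in [h] loses 4 times [f (h p)] before division by
    4, which cancels the bracket of [e] with [T]. *)
Lemma casimir_comm_F p :
  (forall q, h (f q) = f (h q) - f q *+ 2) ->
  (forall q, h (T q) = T (h q) - f q *+ 2) ->
  (forall q, e (T q) = T (e q) + h q) -> (forall q, f (T q) = T (f q)) ->
  casimir h e f (T p) = T (casimir h e f p).
Proof.
move=> hf hT eT fT; rewrite linear_casimir /casimir eT !hT (linearD f) fT.
rewrite (linearB h) (linearMn h) hT !hf.
rewrite -[X in _ + (_ + X)]scaleV4K.
move: (T (h (h p))) (f (h p)) (f p) (T (h p)) (T (f (e p))) => a b c d q.
rewrite addrCA [RHS]addrC; congr (_ + _); rewrite -scalerDr; congr (_ *: _).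
by ring.
Qed.
End CasimirCommutation.

(** * The operators C'_A: commutation and action on lowest-weight vectors *)

Section Casimir.
Variables (K : numFieldType) (n : nat) (lam : 'I_n -> K).
Local Notation pol := {mpoly K[n]}.
Implicit Types (A B : {set 'I_n}) (p : pol).
Local Notation opH := (opH lam).
Local Notation opF := (opF lam).


Fact casimir_set'_is_linear A : linear (casimir_set' lam A).
Proof.
move=> c p q; rewrite /casimir_set'.
have -> : casimir_set lam A (c *: p + q) = c *: casimir_set lam A p + casimir_set lam A q.
  exact: (@casimir_is_linear _ _ (opH A) (opE A) (opF A)).
move: (casimir_set lam A p) (casimir_set lam A q) (_ / 4) => a b d.
by rewrite scalerDr (scalerA d c) (mulrC d) -(scalerA c d) scalerBr opprD addrACA.
Qed.
HB.instance Definition _ A := GRing.isLinear.Build K pol pol _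
  (casimir_set' lam A) (casimir_set'_is_linear A).

Lemma casimir_set'_comm_of A (T : {linear pol -> pol}) p :
  casimir_set lam A (T p) = T (casimir_set lam A p) ->
  casimir_set' lam A (T p) = T (casimir_set' lam A p).
Proof. by move=> AT; rewrite /casimir_set' (linearB T) (linearZZ T) AT. Qed.

(** Brackets between [A] and [B] live on their intersection. If [A] lies in [B] they are those of
    one copy of sl2, whose Casimir is central; if the sets are disjoint they all vanish. *)
Lemma casimir_set'_opH A B p : nested A B ->
  casimir_set' lam A (opH B p) = opH B (casimir_set' lam A p).
Proof.
move=> AB; apply: (@casimir_set'_comm_of A (opH B)); case/orP: AB => AB.
  apply: (@casimir_comm_H _ _ (opH A) (opE A) (opF A) (opH B)) => q.
  - exact: opHH.
  - by rewrite /= opHE setIC (setIidPl AB) addrK.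
  - by rewrite /= opHF setIC (setIidPl AB) subrK.
move/disjoint_setI0: AB => AB.
apply: (@casimir_comm _ _ (opH A) (opE A) (opF A) (opH B)) => q.
- exact: opHH.
- by rewrite /= opHE setIC AB [opE set0 _]delta_set0 mul0rn addr0.
- by rewrite /= opHF setIC AB [opF set0 _]delta_set0 mul0rn subr0.
Qed.

Lemma casimir_set'_opE A B p : nested A B ->
  casimir_set' lam A (opE B p) = opE B (casimir_set' lam A p).
Proof.
move=> AB; apply: (@casimir_set'_comm_of A (opE B)); case/orP: AB => AB.
  apply: (@casimir_comm_E _ _ (opH A) (opE A) (opF A) (opE B)) => q.
  - by rewrite /= opHE setIid.
  - by rewrite /= opHE (setIidPl AB).
  - exact: opEE.
  - by rewrite /= opEF setIC (setIidPl AB) addrK.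
move/disjoint_setI0: AB => AB.
apply: (@casimir_comm _ _ (opH A) (opE A) (opF A) (opE B)) => q.
- by rewrite /= opHE AB [opE set0 _]delta_set0 mul0rn addr0.
- exact: opEE.
- by rewrite /= opEF setIC AB [opH set0 _]delta_set0 addr0.
Qed.

Lemma casimir_set'_opF A B p : nested A B ->
  casimir_set' lam A (opF B p) = opF B (casimir_set' lam A p).
Proof.
move=> AB; apply: (@casimir_set'_comm_of A (opF B)); case/orP: AB => AB.
  apply: (@casimir_comm_F _ _ (opH A) (opE A) (opF A) (opF B)) => q.
  - by rewrite /= opHF setIid.
  - by rewrite /= opHF (setIidPl AB).
  - by rewrite /= opEF (setIidPl AB).
  - exact: opFF.
move/disjoint_setI0: AB => AB.
apply: (@casimir_comm _ _ (opH A) (opE A) (opF A) (opF B)) => q.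
- by rewrite /= opHF AB [opF set0 _]delta_set0 mul0rn subr0.
- by rewrite /= opEF AB [opH set0 _]delta_set0 addr0.
- exact: opFF.
Qed.

(** C'_A commutes with the three generators of [B], hence with their Casimir expression;
    [casimir_comm] is therefore applied to the Casimir of [B], with C'_A in the role of [T]. *)
Lemma casimir_set'_comm A B p : nested A B ->
  casimir_set' lam A (casimir_set' lam B p)
  = casimir_set' lam B (casimir_set' lam A p).
Proof.
move=> AB; rewrite {2 3}/casimir_set'.
rewrite (linearB (casimir_set' lam A)) (linearZZ (casimir_set' lam A)).
congr (_ - _); symmetry.
pose T : {linear pol -> pol} := casimir_set' lam A.
rewrite -[LHS]/(casimir (opH B) (opE B) (opF B) (T p)).
rewrite -[RHS]/(T (casimir (opH B) (opE B) (opF B) p)).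
by apply: casimir_comm => q; symmetry;
  [apply: casimir_set'_opH | apply: casimir_set'_opE | apply: casimir_set'_opF].
Qed.

Lemma casimir_set'_xset A B p : nested A B ->
  casimir_set' lam A (xset K B * p) = xset K B * casimir_set' lam A p.
Proof. by rewrite -!opE_mul; apply: casimir_set'_opE. Qed.

(** Let m = lambda_A + 2k be the weight. Since F kills [p], F E p = - H p, so the Casimir acts by m
    (m - 2) / 4; subtracting the same expression at lambda_A leaves k (k + lambda_A - 1). *)
Lemma casimir_set'_lowest A p (k : nat) :
  opF A p = 0 -> opH A p = (lam_set lam A + 2 * k%:R) *: p ->
  casimir_set' lam A p = (k%:R * (k%:R + lam_set lam A - 1)) *: p.
Proof.
move=> Fp Hp; rewrite /casimir_set'.
have -> : casimir_set lam A p
  = 4^-1 *: (opH A (opH A p) + opH A p *+ 2) + opF A (opE A p) by [].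
rewrite opE_mul opF_xset Fp mulr0 sub0r !Hp (linearZZ (opH A)) /= Hp.
rewrite -scaler_nat !scalerA -!scalerDl -scaleNr scalerA -scalerDl -scaleNr -scalerDl.
by congr (_ *: _); field.
Qed.

(** Each linear factor crossed by [T] contributes [c], so a form of degree [l] contributes [c] times
    [l]. It serves with [c = 2] for H and with [c = 0] for operators commuting with the two linear
    forms. *)
Lemma mul_homog_form (T : {linear pol -> pol}) (c : K) A B (l : nat)
    (a : nat -> K) p :
  (forall q, T (xset K A * q) = xset K A * T q + c *: (xset K A * q)) ->
  (forall q, T (xset K B * q) = xset K B * T q + c *: (xset K B * q)) ->
  let Q := \sum_(s < l.+1) a s *: (xset K A ^+ s * xset K B ^+ (l - s)) in
  T (Q * p) = Q * T p + (c * l%:R) *: (Q * p).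
Proof.
move=> TA TB Q.
have powT D (m : nat) q :
    (forall q, T (xset K D * q) = xset K D * T q + c *: (xset K D * q)) ->
    T (xset K D ^+ m * q)
    = xset K D ^+ m * T q + (c * m%:R) *: (xset K D ^+ m * q).
  move=> TD; elim: m => [|m IH]; first by rewrite !mul1r mulr0 scale0r addr0.
  rewrite exprS -mulrA TD IH mulrDr -scalerAr !mulrA -addrA -scalerDl.
  by rewrite -natr1 mulrDr mulr1.
rewrite /Q !mulr_suml (linear_sum T) scaler_sumr -big_split /=.
apply: eq_bigr => s _; rewrite -scalerAl (linearZZ T) -mulrA !powT //.
have -> : (l%:R : K) = s%:R + (l - s)%:R by rewrite -natrD subnKC // -ltnS.
rewrite -!scalerAl !mulrA (mulrDr c) scalerDl scalerDr mulrDr -!scalerAr !mulrA.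
rewrite !(scalerA _ (a s)) !(mulrC _ (a s)) -!(scalerA (a s)) -!scalerDr.
by rewrite -addrA [X in _ + X]addrC.
Qed.
End Casimir.

(** * Jacobi polynomials as homogeneous forms in x_A and x_B *)

Lemma gbinomS (K : numFieldType) (a : K) (j : nat) :
  j.+1%:R * gbinom a j.+1 = (a - j%:R) * gbinom a j.
Proof.
have fact_neq0 m : m`!%:R != 0 :> K.
  by rewrite Num.Theory.pnatr_eq0 -lt0n fact_gt0.
have := fact_neq0 j; have : j.+1%:R != 0 :> K by rewrite Num.Theory.pnatr_eq0.
rewrite /gbinom big_ord_recr factS natrM /=.
by move: (\prod_(i < j) _) (j`!%:R) (j.+1%:R) => x y z z0 y0; field; rewrite y0.
Qed.

(** In characteristic zero the naturals below [size p] are pairwise distinct, too many to be all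
    roots. *)
Lemma exists_nonroot (K : numFieldType) (p : {poly K}) :
  p != 0 -> exists t, p.[t] != 0.
Proof.
move=> p0; pose s := [seq (i%:R : K) | i <- iota 0 (size p)].
have us : uniq s.
  by rewrite map_inj_uniq ?iota_uniq // => i j /eqP; rewrite Num.Theory.eqr_nat => /eqP.
have /allPn[t _ tN] : ~~ all (root p) s.
  apply/negP => rs; have := max_poly_roots p0 rs us.
  by rewrite size_map size_iota ltnn.
by exists t.
Qed.

Section JacobiForm.
Variables (K : numFieldType) (n : nat).
Local Notation pol := {mpoly K[n]}.
Implicit Types (A B : {set 'I_n}) (p q : pol).

(** The factor 1 / 2^l of the Jacobi polynomial is left out: it cancels against the factors 2 in 1 -
    u and 1 + u. *)
Definition jacobi_coef (a b : K) (l s : nat) : K :=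
  (-1) ^+ s * gbinom (l%:R + a - 1) (l - s) * gbinom (l%:R + b - 1) s.

(** [gbinomS] applied to each of the two binomials gives the same product on both sides, and the
    alternating sign makes the terms cancel. *)
Lemma jacobi_coefS a b l s : (s < l)%N ->
  s.+1%:R * (a + s%:R) * jacobi_coef a b l s.+1
  + (l - s)%:R * (b + (l - s)%:R - 1) * jacobi_coef a b l s = 0.
Proof.
move=> sl; have [t lE] : exists t, l = (s + t.+1)%N.
  by exists (l - s.+1)%N; rewrite addnS -addSn subnKC.
rewrite /jacobi_coef lE subnS addKn /= exprS.
have := gbinomS ((s + t.+1)%:R + a - 1) t; have := gbinomS ((s + t.+1)%:R + b - 1) s.
rewrite !natrD -!natr1.
move: (gbinom _ t.+1) (gbinom _ t) (gbinom _ s.+1) (gbinom _ s) => x y z w zw xy.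
set e := (-1) ^+ s.
have -> : (s%:R + 1) * (a + s%:R) * (-1 * e * y * z) = - (e * (a + s%:R) * y * ((s%:R + 1) * z)) by ring.
have -> : (t%:R + 1) * (b + (t%:R + 1) - 1) * (e * x * w) = e * (b + t%:R) * w * ((t%:R + 1) * x) by ring.
rewrite zw xy; ring.
Qed.

(* The polynomial [x_(A :|: B) ^ l * P_l^(a, b)(u_(A, B))], with denominators
   cleared through [1 - u = 2 x_A / (x_A + x_B)], [1 + u = 2 x_B / (x_A + x_B)]. *)
Definition jacobi_form (a b : K) (l : nat) A B : pol :=
  \sum_(s < l.+1) jacobi_coef a b l s *: (xset K A ^+ s * xset K B ^+ (l - s)).

Lemma jacobiE (a b : K) l : jacobi a b l = (2 ^+ l)^-1 *:
  \sum_(s < l.+1) jacobi_coef a b l s *: ((1 - 'X) ^+ s * (1 + 'X) ^+ (l - s)).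
Proof. by []. Qed.

(** A general morphism [f] lets this serve twice: in the field of fractions, to recognise the
    factors of [coupled_vector], and at scalar values, to show that forms do not vanish. *)
Lemma jacobi_homog (F : fieldType) (f : {rmorphism K -> F}) a b l (x y : F) :
  x + y != 0 ->
  (x + y) ^+ l * (map_poly f (jacobi a b l)).[(y - x) / (x + y)]
  = \sum_(s < l.+1) f (jacobi_coef a b l s) * (x ^+ s * y ^+ (l - s)).
Proof.
move=> xy0; rewrite jacobiE; move: (jacobi_coef a b l) => c.
rewrite map_polyZ hornerZ rmorph_sum horner_sum.
have two0 : 2 != 0 :> F.
  by rewrite -(rmorph_nat f) fmorph_eq0 Num.Theory.pnatr_eq0.
rewrite mulrCA mulr_sumr mulr_sumr; apply: eq_bigr => s _.
rewrite /= map_polyZ hornerZ rmorphM !rmorphXn rmorphB rmorphD rmorph1 /= map_polyX.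
rewrite !hornerE.
have -> : 1 - (y - x) / (x + y) = 2 * x / (x + y) by field.
have -> : 1 + (y - x) / (x + y) = 2 * y / (x + y) by field.
(* The [l]-th powers of 2 and of [x + y] are split along s + (l - s), to match the powers of 1 - u
   and 1 + u. *)
rewrite -{1 2}(subnKC (ltnSE (ltn_ord s))); move: (l - s)%N (c s) => t d.
rewrite fmorphV rmorphXn rmorph_nat !expr_div_n !exprMn.
rewrite !exprD.
have := @expf_neq0 _ _ s two0; have := @expf_neq0 _ _ t two0.
have := @expf_neq0 _ _ s xy0; have := @expf_neq0 _ _ t xy0.
move: ((x + y) ^+ s) ((x + y) ^+ t) (2 ^+ s) (2 ^+ t) (f d) => * /=.
by field; repeat (apply/andP; split).
Qed.

Lemma tofrac_jacobi_form a b l A B :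
  xset K A + xset K B != 0 ->
  tofrac (jacobi_form a b l A B)
  = (tofrac (xset K A) + tofrac (xset K B)) ^+ l
    * (map_poly (@frac_const K n) (jacobi a b l)).[uvar K A B].
Proof.
move=> AB0; have f0 : tofrac (xset K A) + tofrac (xset K B) != 0.
  by rewrite -tofracD tofrac_eq0.
rewrite (jacobi_homog (@tofrac {mpoly K[n]} \o @mpolyC n K) a b l f0) /jacobi_form.
rewrite rmorph_sum /=; apply: eq_bigr => s _.
by rewrite -mul_mpolyC tofracM tofracM !tofracXn.
Qed.

Lemma meval_xset (v : 'I_n -> K) A : meval v (xset K A) = \sum_(i in A) v i.
Proof. by rewrite /xset rmorph_sum /=; apply: eq_bigr => i _; rewrite mevalXU. Qed.

(** At a point where x_A = (1 - t) / 2 and x_B = (1 + t) / 2, the sum is 1 and u = t, so the form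
    takes the value of the Jacobi polynomial at [t], chosen outside its roots. One nonzero
    coordinate in each set is enough to realise these values. *)
Lemma jacobi_form_neq0 a b l A B :
  A != set0 -> B != set0 -> [disjoint A & B] -> jacobi a b l != 0 ->
  jacobi_form a b l A B != 0.
Proof.
case/set0Pn => i iA /set0Pn [j jB] AB /exists_nonroot [t].
have jA : j \notin A by apply: contraL jB => /(disjointFr AB) ->.
have iB : i \notin B by rewrite (disjointFr AB iA).
have ij : i == j = false by apply: contraNF jA => /eqP <-.
pose v (k : 'I_n) := if k == i then (1 - t) / 2 else if k == j then (1 + t) / 2 else 0.
have vA : meval v (xset K A) = (1 - t) / 2.
  rewrite meval_xset (bigD1 i) //= /v eqxx big1 ?addr0 // => k /andP[kA /negPf ->].
  by case: eqP kA jA => // -> ->.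
have vB : meval v (xset K B) = (1 + t) / 2.
  rewrite meval_xset (bigD1 j) //= /v eqxx eq_sym ij big1 ?addr0 // => k /andP[kB /negPf ->].
  by case: eqP kB iB => // -> ->.
apply: contraNneq => J0.
have two0 : 2 != 0 :> K by rewrite Num.Theory.pnatr_eq0.
have vAB : meval v (xset K A) + meval v (xset K B) = 1 by rewrite vA vB; field.
have /(jacobi_homog idfun a b l) : meval v (xset K A) + meval v (xset K B) != 0.
  by rewrite vAB oner_eq0.
rewrite vAB expr1n divr1 mul1r map_poly_id //.
have -> : meval v (xset K B) - meval v (xset K A) = t by rewrite vA vB; field.
move=> ->; apply/eqP.
transitivity (meval v (jacobi_form a b l A B)); last by rewrite J0 rmorph0.
rewrite /jacobi_form [in RHS]rmorph_sum; apply: eq_bigr => s _.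
by rewrite /= mevalZ rmorphM !rmorphXn.
Qed.

End JacobiForm.

(** * Lowest-weight vectors produced by Jacobi forms *)

Section LowestWeight.
Variables (K : numFieldType) (n : nat) (lam : 'I_n -> K).
Local Notation pol := {mpoly K[n]}.
Implicit Types (A B : {set 'I_n}) (p q : pol).
Local Notation opH := (opH lam).
Local Notation opF := (opF lam).

Lemma opH_xset_exp A (c : K) s q : opH A q = c *: q ->
  opH A (xset K A ^+ s * q) = (c + 2 * s%:R) *: (xset K A ^+ s * q).
Proof.
move=> Hq; elim: s => [|s IH]; first by rewrite !mul1r mulr0 addr0.
rewrite exprS -mulrA opH_xset_sub // IH -scalerAr -scalerDl.
by rewrite -(natr1 s) mulrDr mulr1 -addrA.
Qed.

(** Moving F past one factor x_A costs - H, and the weights c, c + 2, ..., c + 2 (s - 1) met on the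
    way add up to s (c + s - 1). At [s = 0] this coefficient is zero, so the value of [s.-1] is
    harmless. *)
Lemma opF_xset_exp A (c : K) s q : opF A q = 0 -> opH A q = c *: q ->
  opF A (xset K A ^+ s * q)
  = - (s%:R * (c + s%:R - 1)) *: (xset K A ^+ s.-1 * q).
Proof.
move=> Fq Hq; elim: s => [|s IH]; first by rewrite mul1r Fq mul0r oppr0 scale0r.
rewrite exprS -mulrA opF_xset IH (opH_xset_exp _ Hq) -scalerAr mulrA -exprS.
case: s {IH} => [|s] /=.
  rewrite mul0r oppr0 scale0r sub0r mulr0 addr0 -scaleNr; congr (_ *: _); ring.
rewrite -scaleNr -scalerDl; congr (_ *: _); rewrite -!natr1; ring.
Qed.

Lemma opF_xset_exp_disj A B s q : [disjoint A & B] ->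
  opF A (xset K B ^+ s * q) = xset K B ^+ s * opF A q.
Proof.
move=> AB; elim: s => [|s IH]; first by rewrite !mul1r.
by rewrite !exprS -!mulrA opF_xset_disj // IH.
Qed.

Lemma opH_xset_exp_disj A B s q : [disjoint A & B] ->
  opH A (xset K B ^+ s * q) = xset K B ^+ s * opH A q.
Proof.
move=> AB; elim: s => [|s IH]; first by rewrite !mul1r.
by rewrite !exprS -!mulrA opH_xset_disj // IH.
Qed.

(** F of the union is F_A + F_B; the first lowers the exponent of x_A, the second that of x_B. Each
    monomial of degree l - 1 thus arises from two neighbouring terms, which cancel by
    [jacobi_coefS]. *)
Lemma opF_jacobi_form a b l A B q : [disjoint A & B] ->
  opF A q = 0 -> opH A q = a *: q -> opF B q = 0 -> opH B q = b *: q ->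
  opF (A :|: B) (jacobi_form a b l A B * q) = 0.
Proof.
move=> AB FA HA FB HB; have BA : [disjoint B & A] by rewrite disjoint_sym.
rewrite /jacobi_form mulr_suml (linear_sum (opF (A :|: B))).
set x := xset K A; set y := xset K B; set c := jacobi_coef a b l.
pose G s := (s%:R * (a + s%:R - 1) * c s) *: (x ^+ s.-1 * (y ^+ (l - s) * q)).
pose H s := ((l - s)%:R * (b + (l - s)%:R - 1) * c s) *:
  (x ^+ s * (y ^+ (l - s).-1 * q)).
have E (s : 'I_l.+1) : opF (A :|: B) (c s *: (x ^+ s * y ^+ (l - s)) * q)
    = - (G s + H s).
  rewrite -scalerAl (linearZZ (opF (A :|: B))) -mulrA /= [opF _ _]delta_setU //.
  have FAy : opF A (y ^+ (l - s) * q) = 0 by rewrite opF_xset_exp_disj // FA mulr0.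
  have HAy : opH A (y ^+ (l - s) * q) = a *: (y ^+ (l - s) * q).
    by rewrite opH_xset_exp_disj // HA scalerAr.
  rewrite -[delta A _ _]/(opF A _) (opF_xset_exp _ FAy HAy).
  rewrite -[delta B _ _]/(opF B _) opF_xset_exp_disj // (opF_xset_exp _ FB HB).
  rewrite -scalerAr scalerDr !scalerA !mulrN !scaleNr -opprD /G /H.
  by rewrite ![c s * _]mulrC.
transitivity (\sum_(s < l.+1) - (G s + H s)); first by apply: eq_bigr => s _; rewrite -E.
rewrite sumrN big_split /=.
(* The terms [G 0] and [H l] vanish; dropping them pairs [G s.+1] with [H s], which carry the same
   monomial. *)
rewrite big_ord_recl [X in _ + X]big_ord_recr /=.
rewrite {1}/G {2}/H subnn !mul0r !scale0r add0r addr0 -big_split /=.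
rewrite big1 ?oppr0 // => s _.
rewrite /G /H /bump /= add1n add0n subnS -scalerDl.
have -> : a + s.+1%:R - 1 = a + s%:R by rewrite -(natr1 s) addrA addrK.
by rewrite jacobi_coefS // scale0r.
Qed.

End LowestWeight.

(** * Combinatorics of coupling schemes: laminarity of the merged blocks *)

Section Scheme.
Variables (n : nat) (I J : 'I_n.-1 -> {set 'I_n}).
Variable P : nat -> {set {set 'I_n}}.
Hypothesis P0 : P 0%N = [set [set i] | i : 'I_n].
Hypothesis stepP : forall b : 'I_n.-1, coupling_step (P b) (I b) (J b) (P b.+1).
Implicit Types (a b : 'I_n.-1) (B : {set 'I_n}).
Local Notation U b := (I b :|: J b).

Lemma step_neq b : I b != J b.
Proof. by case: (stepP b) => _ _ + _; apply: contraTneq => ->; rewrite ltnn. Qed.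

Lemma stepU b : U b \in P b.+1.
Proof. by case: (stepP b) => _ _ _ ->; rewrite setU11. Qed.

Lemma step_blockP b B : B \in P b.+1 ->
  B = U b \/ [/\ B \in P b, B != I b & B != J b].
Proof.
case: (stepP b) => _ _ _ ->; rewrite in_setU1 in_setD in_set2 negb_or.
by case/orP => [/eqP ->|/andP[/andP[BI BJ] BP]]; [left | right].
Qed.

Lemma scheme_partition m : (m <= n.-1)%N -> set0 \notin P m /\ trivIset (P m).
Proof.
elim: m => [_|m IH ltm].
  rewrite P0; split.
    by apply/imsetP => -[i _ /setP/(_ i)]; rewrite !inE eqxx.
  apply/trivIsetP => _ _ /imsetP[i _ ->] /imsetP[j _ ->] ij.
  by rewrite disjoints1 inE; apply: contraNneq ij => ->.
have [P0N /trivIsetP tP] := IH (ltnW ltm).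
pose b := Ordinal ltm; have [bI bJ _ _] := stepP b.
split.
  apply/negP => /(@step_blockP b)[/esym/eqP|[/(negP P0N)//]].
  by rewrite setU_eq0 => /andP[/eqP I0 _]; rewrite -I0 bI in P0N.
apply/trivIsetP => B C /(@step_blockP b) hB /(@step_blockP b) hC.
have disjU D : D \in P b -> D != I b -> D != J b -> [disjoint U b & D].
  move=> DP DI DJ; rewrite -setI_eq0 setIUl setU_eq0 !setI_eq0.
  by rewrite !tP // eq_sym.
case: hB hC => [->|[BP BI BJ]] [->|[CP CI CJ]]; rewrite ?eqxx //.
- by move=> _; apply: disjU.
- by move=> _; rewrite disjoint_sym; apply: disjU.
- exact: tP.
Qed.

Lemma scheme_disjoint m B C : (m <= n.-1)%N ->
  B \in P m -> C \in P m -> B != C -> [disjoint B & C].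
Proof. by case/scheme_partition => _ /trivIsetP tP; apply: tP. Qed.

Lemma step_disjoint b : [disjoint I b & J b].
Proof.
case: (stepP b) => bI bJ _ _.
exact: (scheme_disjoint (ltnW (ltn_ord b)) bI bJ (step_neq b)).
Qed.

Lemma scheme_neq0 m B : (m <= n.-1)%N -> B \in P m -> B != set0.
Proof. by case/scheme_partition => P0N _; apply: contraTneq => ->. Qed.

Lemma step_neq0 b : I b != set0 /\ J b != set0.
Proof.
case: (stepP b) => bI bJ _ _.
by split; apply: (scheme_neq0 (ltnW (ltn_ord b))).
Qed.

Lemma scheme_coarsen l m B : (l <= m <= n.-1)%N -> B \in P l ->
  exists2 C, C \in P m & B \subset C.
Proof.
case/andP; elim: m => [|m IH]; first by rewrite leqn0 => /eqP -> _; exists B.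
rewrite leq_eqVlt => /predU1P[-> _ ?|]; first by exists B.
rewrite ltnS => lm ltm BP; have [C CP BC] := IH lm (ltnW ltm) BP.
pose b := Ordinal ltm.
have [/orP CIJ|] := boolP ((C == I b) || (C == J b)).
  exists (U b); first exact: stepU.
  by apply: subset_trans BC _; case: CIJ => /eqP ->; rewrite ?subsetUl ?subsetUr.
move=> CIJ; exists C => //; case: (stepP b) => _ _ _ /= ->.
by rewrite in_setU1 in_setD in_set2 CIJ CP orbT.
Qed.

(** The block formed at step [a] survives inside some block of the coarser partition [P m], and that
    block either is [B] or is disjoint from it. *)
Lemma step_nested m B a : (a < m <= n.-1)%N -> B \in P m -> nested (U a) B.
Proof.
move=> am BP; have [C CP UC] := scheme_coarsen am (stepU a).
have [<-|CB] := eqVneq C B; first by rewrite /nested UC.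
case/andP: am => _ mn; apply/orP; right.
exact: disjointWl UC (scheme_disjoint mn CP BP CB).
Qed.

Lemma step_laminar a b : (a <= b)%N -> nested (U a) (U b).
Proof. by move=> ab; apply: (@step_nested b.+1) (stepU b); rewrite ltnS ab ltn_ord. Qed.

Lemma step_nestedIJ a b : (a < b)%N -> nested (U a) (I b) /\ nested (U a) (J b).
Proof.
move=> ab; case: (stepP b) => bI bJ _ _.
by split; apply: (@step_nested b) => //; rewrite ab ltnW.
Qed.

(** An earlier block inside [U b] must lie in [I b] or in [J b]: by nestedness it would otherwise be
    disjoint from both, hence empty. The bound is written [b.+1] to fit the products indexed by
    stages in [opF_prod_block]. *)
Lemma preceqE a b : preceq I J a b = (a < b.+1)%N && (U a \subset U b).
Proof.
rewrite /preceq /precL /precR; have [->|ab] := eqVneq; first by rewrite ltnS leqnn subxx.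
rewrite [in RHS]ltnS [in RHS]leq_eqVlt (inj_eq (@ord_inj _)) (negPf ab) /=.
have [lt_ab|] //= := boolP (a < b)%N.
apply/orP/idP => [[]/subset_trans->//|Uab]; rewrite ?subsetUl ?subsetUr //.
have [/orP[sI|dI] /orP[sJ|dJ]] := step_nestedIJ lt_ab;
  [by left | by left | by right | ].
have : [disjoint U a & U b] by rewrite -setI_eq0 setIUr setU_eq0 !setI_eq0 dI.
rewrite -setI_eq0 (setIidPl Uab) setU_eq0 => /andP[/eqP I0 _].
by have [] := step_neq0 a; rewrite I0 eqxx.
Qed.

(** This lets C' of [U b] pass through the factor of index [a]. If [a] comes before [b], the two
    merged blocks are disjoint; if [a] comes after [b], [U b] is an earlier block, nested with
    respect to [I a] and [J a]. *)
Lemma not_preceq_nested a b : ~~ preceq I J a b ->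
  nested (U b) (I a) /\ nested (U b) (J a).
Proof.
rewrite /preceq /precL /precR !negb_or; case/and3P => ab nL nR.
have [lt_ab|lt_ba|/val_inj/eqP] := ltngtP a b; last by rewrite (negPf ab).
  rewrite !lt_ab /= in nL nR; have [] := step_nestedIJ lt_ab.
  rewrite /nested (negPf nL) (negPf nR) /= => dI dJ.
  have : [disjoint U b & U a].
    by rewrite disjoint_sym -setI_eq0 setIUr setU_eq0 !setI_eq0 dI.
  by move=> d; split; apply/orP; right; apply: disjointWr d;
    rewrite ?subsetUl ?subsetUr.
by have [] := step_nestedIJ lt_ba.
Qed.

Lemma precL_precR a b : precL I J a b -> precR I J a b = false.
Proof.
rewrite /precL /precR => /andP[-> /= aI]; apply/negP => aJ.
have := disjointWl aI (disjointWr aJ (step_disjoint b)).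
by rewrite -setI_eq0 setIid setU_eq0; have [/negPf->] := step_neq0 a.
Qed.

(** The recursion along the binary tree of blocks: below [b] come [b] itself and the two disjoint
    subtrees under [I b] and [J b]. *)
Lemma big_preceq (T : Type) (idx : T) (op : Monoid.com_law idx)
    (F : 'I_n.-1 -> T) b :
  \big[op/idx]_(a | preceq I J a b) F a
  = op (F b) (op (\big[op/idx]_(a | precL I J a b) F a)
                 (\big[op/idx]_(a | precR I J a b) F a)).
Proof.
have LN a : precL I J a b -> a != b by apply: contraTneq => ->; rewrite /precL ltnn.
have RN a : precR I J a b -> a != b by apply: contraTneq => ->; rewrite /precR ltnn.
rewrite (bigD1 b) /=; last by rewrite /preceq eqxx.
rewrite (bigID (fun a => precL I J a b)) /=; congr (op _ (op _ _)); apply: eq_bigl => a.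
  by rewrite /preceq; have [/LN ->|_] := boolP (precL I J a b); rewrite ?orbT ?andbF.
rewrite /preceq; have [L|_] /= := boolP (precL I J a b).
  by rewrite andbF precL_precR.
by have [/RN/negPf ->|_] := boolP (precR I J a b); rewrite ?orbF ?andbN.
Qed.

End Scheme.

(** * The coupled vectors and their eigenvalues *)

Section Coupled.
Variables (K : numFieldType) (n : nat) (lam : 'I_n -> K).
Variables (I J : 'I_n.-1 -> {set 'I_n}) (k : 'I_n.-1 -> nat).
Variable P : nat -> {set {set 'I_n}}.
Hypothesis P0 : P 0%N = [set [set i] | i : 'I_n].
Hypothesis stepP : forall b : 'I_n.-1, coupling_step (P b) (I b) (J b) (P b.+1).
Local Notation pol := {mpoly K[n]}.
Implicit Types (a b : 'I_n.-1) (A B : {set 'I_n}) (p q : pol) (D : pred 'I_n.-1).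
Local Notation opH := (opH lam).
Local Notation opF := (opF lam).
Local Notation U b := (I b :|: J b).

Definition coupled_form b : pol :=
  jacobi_form (lamL lam I J k b) (lamR lam I J k b) (k b) (I b) (J b).
Local Notation Q := coupled_form.

Lemma mul_coupled_form (T : {linear pol -> pol}) (c : K) b q :
  (forall p, T (xset K (I b) * p) = xset K (I b) * T p + c *: (xset K (I b) * p)) ->
  (forall p, T (xset K (J b) * p) = xset K (J b) * T p + c *: (xset K (J b) * p)) ->
  T (Q b * q) = Q b * T q + (c * (k b)%:R) *: (Q b * q).
Proof. by move=> TI TJ; apply: mul_homog_form. Qed.

Lemma linear_prod_coupled_form (T : {linear pol -> pol}) D q :
  (forall a, D a -> forall p, T (xset K (I a) * p) = xset K (I a) * T p) ->
  (forall a, D a -> forall p, T (xset K (J a) * p) = xset K (J a) * T p) ->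
  T (\prod_(a | D a) Q a * q) = \prod_(a | D a) Q a * T q.
Proof.
move=> TI TJ.
suff : forall p, T (\prod_(a | D a) Q a * p) = \prod_(a | D a) Q a * T p by [].
apply: (big_ind (fun x : pol => forall p, T (x * p) = x * T p)).
- by move=> p; rewrite !mul1r.
- by move=> x y Tx Ty p; rewrite -!mulrA Tx Ty.
- move=> a Da p; rewrite (@mul_coupled_form T 0) ?mul0r ?scale0r ?addr0 //;
    by move=> r; rewrite scale0r addr0 ?TI ?TJ.
Qed.

Lemma opH1 B : opH B 1 = lam_set lam B *: 1.
Proof.
rewrite /opH /delta /lam_set scaler_suml; apply: eq_bigr => i _.
by rewrite /actH -mpolyC1 mderivC mulr0 mul0rn addr0.
Qed.

Lemma opF1 B : opF B 1 = 0.
Proof.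
rewrite /opF /delta big1 // => i _.
by rewrite /actF -mpolyC1 mderivC mderiv0 mulr0 scaler0 oppr0 addr0.
Qed.

(** The constant 1 has weight lambda_B, and each factor, homogeneous of degree [k a] in variables
    from [B], raises the weight by twice [k a]. *)
Lemma opH_prod_coupled_form B D : (forall a, D a -> U a \subset B) ->
  opH B (\prod_(a | D a) Q a)
  = (lam_set lam B + 2 * (\sum_(a | D a) k a)%N%:R) *: \prod_(a | D a) Q a.
Proof.
move=> DB; apply: (big_rec2 (fun (x : pol) (m : nat) =>
  opH B x = (lam_set lam B + 2 * m%:R) *: x)).
  by rewrite mulr0 addr0 opH1.
move=> a x m Da Hx; have := DB a Da; rewrite subUset => /andP[aI aJ].
rewrite (@mul_coupled_form (opH B) 2) /= => [|p|p]; last 2 first.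
- exact: opH_xset_sub.
- exact: opH_xset_sub.
by rewrite Hx -scalerAr -scalerDl natrD mulrDr addrCA [2 * (k a)%:R + _]addrC.
Qed.

(** Stated for every block of every stage, so that at a merge the induction hypothesis covers both
    [I b] and [J b]. *)
Lemma opF_prod_block m B : (m <= n.-1)%N -> B \in P m ->
  opF B (\prod_(a : 'I_n.-1 | (a < m)%N && (U a \subset B)) Q a) = 0.
Proof.
elim: m B => [|m IH] B ltm BP; first by rewrite big_pred0 ?opF1.
pose b := Ordinal ltm; have [bI bJ _ _] := stepP b.
have IJ := step_disjoint P0 stepP b.
have := step_blockP stepP (b := b) BP; case=> [->|[BPm BI BJ]].
  (* Case of the block just created: its product is the factor of [b] times those of the left and
     right subtrees. *)
  rewrite -(eq_bigl _ _ (fun a => preceqE P0 stepP a b)).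
  rewrite (big_preceq P0 stepP) /=.
  set QL := \prod_(a | precL I J a b) Q a; set QR := \prod_(a | precR I J a b) Q a.
  have LI a : precL I J a b -> U a \subset I b by case/andP.
  have RJ a : precR I J a b -> U a \subset J b by case/andP.
  have disjL a : precL I J a b -> [disjoint J b & I a] /\ [disjoint J b & J a].
    move/LI; rewrite subUset => /andP[aI aJ].
    by rewrite !(disjoint_sym (J b)) (disjointWl aI IJ) (disjointWl aJ IJ).
  have disjR a : precR I J a b -> [disjoint I b & I a] /\ [disjoint I b & J a].
    move/RJ; rewrite subUset => /andP[aI aJ].
    by rewrite (disjointWr aI IJ) (disjointWr aJ IJ).
  (* The right subtree involves only variables of [J b], so it passes through the operators of
     [I b]; the left subtree is treated symmetrically. *)
  have commR (X : {linear pol -> pol}) q :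
      (forall A p, [disjoint I b & A] -> X (xset K A * p) = xset K A * X p) ->
      X (QR * q) = QR * X q.
    by move=> XA; apply: linear_prod_coupled_form => a /disjR[dI dJ] p; apply: XA.
  have commL (X : {linear pol -> pol}) q :
      (forall A p, [disjoint J b & A] -> X (xset K A * p) = xset K A * X p) ->
      X (QL * q) = QL * X q.
    by move=> XA; apply: linear_prod_coupled_form => a /disjL[dI dJ] p; apply: XA.
  (* The parameters [lamL] and [lamR] at [b] are exactly the weights of [QL * QR] for [I b] and
     [J b]. *)
  apply: opF_jacobi_form => //.
  - rewrite [QL * _]mulrC (commR (opF (I b))) /= => [|A p]; last exact: opF_xset_disj.
    by rewrite (IH (I b) (ltnW ltm) bI) mulr0.
  - rewrite [QL * _]mulrC (commR (opH (I b))) /= => [|A p]; last exact: opH_xset_disj.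
    by rewrite opH_prod_coupled_form // scalerAr.
  - rewrite (commL (opF (J b))) /= => [|A p]; last exact: opF_xset_disj.
    by rewrite (IH (J b) (ltnW ltm) bJ) mulr0.
  - rewrite (commL (opH (J b))) /= => [|A p]; last exact: opH_xset_disj.
    by rewrite opH_prod_coupled_form // scalerAr.
(* Case of an older block: being disjoint from the nonempty [I b], it cannot contain [U b], so its
   product gains no factor at this stage. *)
rewrite -[RHS](IH B (ltnW ltm) BPm); congr (opF B _); apply: eq_bigl => a.
rewrite ltnS leq_eqVlt; case: eqP => //= am; rewrite am ltnn /=.
have -> : a = b by apply: val_inj.
apply/negP => UB; have dIB : [disjoint I b & B].
  by apply: (scheme_disjoint P0 stepP (ltnW ltm)) => //; rewrite eq_sym.
have := disjointWr (subset_trans (subsetUl _ _) UB) dIB.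
by rewrite -setI_eq0 setIid; have [/negPf->] := step_neq0 P0 stepP b.
Qed.

Lemma casimir_prod_coupled_form b :
  casimir_set' lam (U b) (\prod_a Q a) = eigval lam I J k b *: \prod_a Q a.
Proof.
rewrite (bigID (fun a => ~~ preceq I J a b)) /=.
rewrite (linear_prod_coupled_form (T := casimir_set' lam (U b))) => [|a|a]; last 2 first.
- by move=> /(not_preceq_nested P0 stepP)[nI _] p; apply: casimir_set'_xset.
- by move=> /(not_preceq_nested P0 stepP)[_ nJ] p; apply: casimir_set'_xset.
rewrite /= scalerAr; congr (_ * _); under eq_bigl do rewrite negbK.
rewrite (@casimir_set'_lowest _ _ _ _ _ (ksum I J k b)).
- congr (_ *: _); rewrite /eigval [lam_set lam (U b)]sum_disjointU ?addrA //.
  exact: (step_disjoint P0 stepP).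
- rewrite (eq_bigl _ _ (fun a => preceqE P0 stepP a b)).
  by apply: opF_prod_block => //; apply: stepU.
- apply: opH_prod_coupled_form => a.
  by rewrite (preceqE P0 stepP) => /andP[].
Qed.

(** Its value at the all-ones point is the cardinal of [A], nonzero in characteristic zero. *)
Lemma xset_neq0 A : A != set0 -> xset K A != 0.
Proof.
move=> A0; apply: contraNneq A0 => /(congr1 (meval (fun=> 1))).
rewrite meval_xset sumr_const rmorph0 => /eqP.
by rewrite Num.Theory.pnatr_eq0 cards_eq0.
Qed.

Lemma xsetU A B : [disjoint A & B] -> xset K (A :|: B) = xset K A + xset K B.
Proof. exact: sum_disjointU. Qed.

Lemma tofrac_prod_coupled_form :
  tofrac (\prod_a Q a) = coupled_vector lam I J k.
Proof.
rewrite rmorph_prod; apply: eq_bigr => b _.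
have U0 : xset K (I b) + xset K (J b) = xset K (U b).
  by rewrite xsetU //; apply: (step_disjoint P0 stepP).
rewrite [LHS]tofrac_jacobi_form; first by rewrite -tofracD U0.
rewrite U0 xset_neq0 // setU_eq0 negb_and.
by have [->] := step_neq0 P0 stepP b.
Qed.

(** The condition excludes exceptional parameters: for instance the Jacobi polynomial of degree 1
    with both parameters 0 is identically zero. *)
Lemma prod_coupled_form_neq0 :
  (forall b, jacobi_factor lam I J k b != 0) -> \prod_a Q a != 0.
Proof.
move=> jac0; apply/prodf_neq0 => b _; have [I0 J0] := step_neq0 P0 stepP b.
by apply: jacobi_form_neq0; [| | exact: (step_disjoint P0 stepP) | exact: jac0].
Qed.

End Coupled.

Theorem proposition5p6 (R : realType) (n : nat) (hn : (3 <= n)%N)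
    (lam : 'I_n -> R[i]) (I J : 'I_n.-1 -> {set 'I_n})
    (hIJ : coupling_scheme I J) :
  (forall (b c : 'I_n.-1) (p : {mpoly R[i][n]}),
     casimir_set' lam (I b :|: J b) (casimir_set' lam (I c :|: J c) p)
     = casimir_set' lam (I c :|: J c) (casimir_set' lam (I b :|: J b) p))
  /\
  (forall k : 'I_n.-1 -> nat,
     exists v : {mpoly R[i][n]},
       [/\ tofrac v = coupled_vector lam I J k,
           (forall b : 'I_n.-1, jacobi_factor lam I J k b != 0) -> v != 0
         & forall b : 'I_n.-1,
             casimir_set' lam (I b :|: J b) v = eigval lam I J k b *: v]).
Proof.
case: hIJ => P [P0 _ stepP]; split=> [b c p|k].
  (* Nestedness is oriented from the earlier block to the later one, hence the two orders. *)
  have [bc|/ltnW cb] := leqP b c.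
    exact: casimir_set'_comm (step_laminar P0 stepP bc).
  by symmetry; apply: casimir_set'_comm (step_laminar P0 stepP cb).
exists (\prod_a coupled_form lam I J k a); split.
- exact: tofrac_prod_coupled_form P0 stepP.
- exact: prod_coupled_form_neq0 P0 stepP.
- exact: casimir_prod_coupled_form P0 stepP.
Qed.
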